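(* Let $(S_i)_{i\in I}$ be a family of compact spindle starshaped sets in $\mathbb{E}^d$ with $\operatorname{card} I\ge d+1$, and let $K$ be a compact set in $\mathbb{E}^d$. Assume that for every $i_1,\ldots,i_{d+1}\in I$ there is a vector $u\in\mathbb{E}^d$ such that $u+K\subseteq\ker_{\mathrm{s}}\big(\bigcap_{j=1}^{d+1}S_{i_j}\big)$. Then there is a vector $v\in\mathbb{E}^d$ such that $v+K\subseteq\ker_{\mathrm{s}}\big(\bigcap_{i\in I}S_i\big)$.
   Context: For $x,y\in\mathbb{E}^d$ the spindle $[x,y]_{\mathrm{s}}$ is the intersection of all closed unit balls containing $x$ and $y$ if $|x-y|\le2$, and $\mathbb{E}^d$ otherwise. For $A\subseteq\mathbb{E}^d$, $p\in A$: $\operatorname{st}_{\mathrm{s}}(p,A)=\{q\in A:[p,q]_{\mathrm{s}}\subseteq A\}$; $\ker_{\mathrm{s}}A=\{p\in A:\operatorname{st}_{\mathrm{s}}(p,A)=A\}$; $A$ is spindle starshaped if $\ker_{\mathrm{s}}A\ne\emptyset$. *)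

(* Defs.v *)
(* E^d is modelled as row vectors 'rV[R]_d over an
   arbitrary R : realType, with the Euclidean norm defined explicitly.
   The topology on 'rV[R]_d (used for [compact]) is the product topology,
   i.e. the Euclidean one. *)
From HB Require Import structures.
From mathcomp Require Import all_boot all_order all_algebra.
From mathcomp Require Import all_classical all_reals all_analysis.
Set Implicit Arguments. Unset Strict Implicit. Unset Printing Implicit Defensive.
Import Order.TTheory GRing.Theory Num.Theory.
Local Open Scope classical_set_scope.
Local Open Scope ring_scope.

Section Spindle.
Variables (R : realType) (d : nat).
Notation E := 'rV[R]_d.

Definition edist (x y : E) : R := Num.sqrt (\sum_(i < d) (x ord0 i - y ord0 i) ^+ 2).

Definition cball1 (c : E) : set E := [set z | edist z c <= 1].

Definition spindle (x y : E) : set E :=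
  if edist x y <= 2 then
    [set z | forall c : E, cball1 c x -> cball1 c y -> cball1 c z]
  else setT.

Definition st_s (p : E) (A : set E) : set E :=
  [set q | A q /\ spindle p q `<=` A].

Definition ker_s (A : set E) : set E :=
  [set p | A p /\ st_s p A = A].

Definition spindle_starshaped (A : set E) : Prop := ker_s A !=set0.

End Spindle.

(* Main.v *)
Require Import Defs.
From HB Require Import structures.
From mathcomp Require Import all_boot all_order all_algebra.
From mathcomp Require Import all_classical all_reals all_analysis.
From mathcomp Require Import ring lra.
Import Order.TTheory GRing.Theory Num.Theory numFieldNormedType.Exports.

(** Let X be the intersection of all the sets S_i. The vector v we look for is
    a common point of the compact sets
      T_i = {u : u + k is in S_i and [u + k, x]_s lies in S_i for all k in K, x in X}.
    If c + K lies in the spindle kernel of the intersection of S_i, i in J, then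
    the intersection of T_i, i in J, contains c and is starshaped (in the usual
    sense) about c. So it suffices to prove a topological Helly theorem: if all
    the intersections of at most n - 1 out of n > d + 1 compact sets in E^d are
    starshaped, then the n sets have a common point. This theorem is applied
    repeatedly to pass from d + 1 to any finite number of sets; compactness of
    the T_i does the rest.

    The Helly theorem is proved by a Sperner argument modulo 2. If the n sets
    have no common point, every point x gets a label j with x not in T_j, in such
    a way that at most d + 1 labels occur near any point. Coning from the
    centres of the intersections produces a singular simplex all of whose small
    pieces must carry few labels, whereas Sperner's parity count yields a piece
    with all n labels.

    That T_i, i in J, is starshaped reduces to the equality of the spindle
    convex hull of {c, p, x} with the union of the spindles [c, w]_s over
    w in [p, x]_s. It follows from first-order optimality conditions at an extremal
    centre b of a unit ball through the three points: z lies on the great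
    circle arc of the sphere about b from c to a point w of the arc p x. *)

Set Implicit Arguments. Unset Strict Implicit.

(** * Cochains modulo 2 *)

(* The coboundary modulo 2: the sum of the values on all faces, i.e. on all
   deletions of one entry. Tuples are augmented by the empty one. *)
Fixpoint cobd (T : Type) (phi : seq T -> bool) (s : seq T) : bool :=
  if s is x :: s' then phi s' (+) cobd (fun r => phi (x :: r)) s' else false.

Lemma cobd_map (T U : Type) (f : T -> U) (phi : seq U -> bool) s :
  cobd (fun r => phi (map f r)) s = cobd phi (map f s).
Proof. by elim: s phi => //= x s IHs phi; rewrite (IHs (fun r => phi (f x :: r))). Qed.

Section Cochains.
Variable T : eqType.
Implicit Types (phi psi : seq T -> bool) (s r : seq T) (f g : T -> T).

(* The dual of the prism operator of the homotopy from f to g. *)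
Fixpoint prism f g phi s : bool :=
  if s is x :: s' then
    phi [:: f x, g x & map g s'] (+) prism f g (fun r => phi (f x :: r)) s'
  else false.

Lemma cobd_local phi psi s :
  (forall r, (size r).+1 = size s -> {subset r <= s} -> phi r = psi r) ->
  cobd phi s = cobd psi s.
Proof.
elim: s phi psi => //= x s IHs phi psi eqphi; congr addb.
  by apply: eqphi => // y ys; rewrite inE ys orbT.
apply: IHs => r sr rs; apply: eqphi; first by rewrite /= sr.
by move=> y; rewrite !inE => /orP[->//|/rs ->]; rewrite orbT.
Qed.

Lemma prism_local f g phi psi s :
  (forall r, size r = (size s).+1 ->
     (forall y, y \in r -> exists2 x, x \in s & y = f x \/ y = g x) ->
     phi r = psi r) ->
  prism f g phi s = prism f g psi s.
Proof.
elim: s phi psi => //= x s IHs phi psi eqphi; congr addb.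
  apply: eqphi; first by rewrite /= size_map.
  move=> y; rewrite !inE => /or3P[/eqP->|/eqP->|/mapP[z zs ->]].
  - by exists x; [rewrite inE eqxx|left].
  - by exists x; [rewrite inE eqxx|right].
  - by exists z; [rewrite inE zs orbT|right].
apply: IHs => r sr rs; apply: eqphi; first by rewrite /= sr.
move=> y; rewrite inE => /orP[/eqP->|/rs[z zs zy]].
  by exists x; [rewrite inE eqxx|left].
by exists z; rewrite // inE zs orbT.
Qed.

Lemma eq_cobd phi psi : phi =1 psi -> cobd phi =1 cobd psi.
Proof. by move=> eqphi s; apply: cobd_local => r _ _. Qed.

Lemma cobd0 s : cobd (fun=> false) s = false.
Proof. by elim: s. Qed.

Lemma cobdD phi psi s : cobd (fun r => phi r (+) psi r) s = cobd phi s (+) cobd psi s.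
Proof. by elim: s phi psi => //= x s IHs phi psi; rewrite IHs addbACA. Qed.

Lemma cobd_sum I (t : seq I) (F : I -> seq T -> bool) s :
  cobd (fun r => \big[addb/false]_(i <- t) F i r) s =
  \big[addb/false]_(i <- t) cobd (F i) s.
Proof.
elim: t => [|i t IHt].
  by rewrite big_nil -{2}(cobd0 s); apply: eq_cobd => r; rewrite big_nil.
by rewrite big_cons -IHt -cobdD; apply: eq_cobd => r; rewrite big_cons.
Qed.

Lemma prismD f g phi psi s :
  prism f g (fun r => phi r (+) psi r) s = prism f g phi s (+) prism f g psi s.
Proof. by elim: s phi psi => //= x s IHs phi psi; rewrite IHs addbACA. Qed.

(** The homotopy formula, dual to the fact that the boundary of a prism consists of its two ends and
    the prism over the boundary; signs disappear modulo 2. *)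
Lemma prism_cobd f g phi s :
  prism f g (cobd phi) s = phi (map g s) (+) phi (map f s) (+) cobd (prism f g phi) s.
Proof.
elim: s phi => [|x s IHs] phi /=; first by rewrite addbb.
rewrite prismD IHs cobdD.
rewrite (cobd_map g (fun r => phi [:: f x, g x & r])).
have xorE (a b c d e h : bool) : a (+) (b (+) c) (+) (d (+) (b (+) e (+) h)) =
  a (+) e (+) (d (+) (c (+) h)) by case: a b c d e h => [] [] [] [] [] [].
exact: xorE.
Qed.

End Cochains.

(** * Rainbow words and Sperner's parity count *)

Section Rainbow.
Variable J : finType.
Implicit Types (sg : {set J}) (l : seq J).

(* rainbow sg l: the word l lists every element of sg exactly once. *)
Fixpoint rainbow sg l : bool :=
  if l is x :: l' then (x \in sg) && rainbow (sg :\ x) l' else sg == finset.set0.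

Lemma rainbowP sg l : rainbow sg l -> sg =i l.
Proof.
elim: l sg => [|x l IHl] sg /=; first by move=> /eqP-> y; rewrite inE.
case/andP => xsg /IHl eql y; rewrite inE -eql !inE.
by case: eqVneq => [->|].
Qed.

(** Only the deletion of a sole occurrence of [x] leaves a word avoiding [x], so at most one face
    contributes. *)
Lemma cobd_rainbow_mem sg x l : x \in sg -> x \in l ->
  cobd (rainbow (sg :\ x)) l = rainbow sg l.
Proof.
elim: l sg => // y l IHl sg xsg /=; have [->{y} _|yx] := eqVneq y x.
  rewrite xsg finset.setD11 /= -[RHS]addbF; congr addb.
  by rewrite (eq_cobd (psi := fun=> false)) ?cobd0.
rewrite inE eq_sym (negPf yx) /= => xl.
have -> : rainbow (sg :\ x) l = false.
  by apply/negP => /rainbowP/(_ x); rewrite xl finset.setD11.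
rewrite !inE yx /=; case: (y \in sg) => /=; last exact: cobd0.
by rewrite finset.setDDl finset.setUC -finset.setDDl IHl // !inE eq_sym yx.
Qed.

(* The parity count of Sperner's lemma. *)
Lemma cobd_rainbow sg j l : j \in sg -> {subset l <= sg} ->
  cobd (rainbow (sg :\ j)) l = rainbow sg l.
Proof.
elim: l sg => [|x l IHl] sg jsg lsg /=.
  by apply/esym/negP => /eqP sg0; rewrite sg0 inE in jsg.
have xsg : x \in sg by apply: lsg; rewrite inE eqxx.
rewrite xsg /= !inE; have [->|xj] := eqVneq x j => /=.
  by rewrite cobd0 addbF.
rewrite xsg; have swap : sg :\ j :\ x = sg :\ x :\ j by rewrite !finset.setDDl finset.setUC.
(* If [x] occurs again in the tail, deleting the head and deleting inside the tail contribute the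
   same value, and they cancel. *)
have [xl|xl] := boolP (x \in l).
  rewrite (@cobd_rainbow_mem (sg :\ j)) ?addbb; last 2 first.
  - by rewrite !inE xj.
  - exact: xl.
  by apply/esym/negP => /rainbowP/(_ x); rewrite xl finset.setD11.
have -> : rainbow (sg :\ j) l = false.
  by apply/negP => /rainbowP/(_ x); rewrite (negPf xl) !inE xj xsg.
rewrite swap IHl //; first by rewrite !inE eq_sym xj.
move=> y yl; rewrite !inE lsg ?inE ?yl ?orbT // andbT.
by apply: contraNneq xl => <-.
Qed.

End Rainbow.

(** A face of codimension two is reached by deleting [j] and [k] in either order, so its two
    contributions cancel: a double boundary vanishes modulo 2. *)
Lemma addb_sum_sym (J : finType) (sg : {set J}) (F : {set J} -> bool) :
  \big[addb/false]_(j in sg) \big[addb/false]_(k in sg :\ j) F (sg :\ j :\ k) = false.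
Proof.
have -> : \big[addb/false]_(j in sg) \big[addb/false]_(k in sg :\ j) F (sg :\ j :\ k) =
  \big[addb/false]_(p : J * J | [&& p.1 \in sg, p.2 \in sg & p.2 != p.1])
    F (sg :\ p.1 :\ p.2).
  rewrite pair_big_dep /=; apply: eq_bigl => -[j k] /=.
  by rewrite !inE; case: (j \in sg); rewrite //= andbC.
rewrite (bigID (fun p : J * J => enum_rank p.1 < enum_rank p.2)) /=.
rewrite [X in _ (+) X](reindex_inj (h := fun p : J * J => (p.2, p.1))) /=; last first.
  by move=> [a b] [c e] [-> ->].
set a := bigop.body _ _ _; set b := bigop.body _ _ _.
suff -> : a = b by rewrite addbb.
apply: eq_big => [[j k]|[j k] _] /=; last by rewrite !finset.setDDl finset.setUC.
case: (eqVneq j k) => [->|jk]; first by rewrite !andbF.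
rewrite /= !andbT -leqNgt [in RHS]leq_eqVlt.
have /negPf-> : (enum_rank j : nat) != enum_rank k.
  by apply: contraNneq jk => /val_inj/enum_rank_inj->.
by case: (j \in sg); case: (k \in sg).
Qed.

(** * Iterated cones and the existence of a small rainbow tuple *)

Section ConeChain.
Variables (T : eqType) (J : finType).
Implicit Types (sg : {set J}) (phi psi : seq T -> bool).
Variables (N : nat) (H : {set J} -> nat -> T -> T) (C : {set J} -> T).

(* The dual of the cone operator: deform a tuple by h 0, ..., h N and then join
   it to the apex c. *)
Definition cone (h : nat -> T -> T) (c : T) (phi : seq T -> bool) s : bool :=
  \big[addb/false]_(0 <= t < N) prism (h t) (h t.+1) phi s (+) phi (c :: map (h N) s).

(** Dual to the boundary formula of a cone. The prism formulas telescope from the identity to [h N],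
    and the term with apex [c] cancels the end at [h N]. *)
Lemma cone_cobd h c phi s : h 0 =1 id ->
  cone h c (cobd phi) s = phi s (+) cobd (cone h c phi) s.
Proof.
move=> h0; rewrite /cone /= cobdD.
have -> : cobd (fun s => phi (c :: map (h N) s)) s =
          cobd (fun r => phi (c :: r)) (map (h N) s).
  exact: (cobd_map (h N) (fun r => phi (c :: r))).
rewrite cobd_sum (eq_bigr _ (fun t _ => prism_cobd (h t) (h t.+1) phi s)) big_split /=.
have -> : \big[addb/false]_(0 <= t < N) (phi (map (h t.+1) s) (+) phi (map (h t) s)) =
          phi (map (h N) s) (+) phi s.
  elim: N => [|n IHn].
    by rewrite big_geq // (eq_map h0) map_id addbb.
  rewrite big_nat_recr //= IHn.
  have xorE (x y z : bool) : x (+) y (+) (z (+) x) = z (+) y by case: x y z => [] [] [].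
  exact: xorE.
have xorE (x y z w : bool) : x (+) y (+) z (+) (x (+) w) = y (+) (z (+) w).
  by case: x y z w => [] [] [] [].
exact: xorE.
Qed.

(* For k = #|sg|, the k-vertex chain obtained by coning the sum of the chains of
   the facets of sg to C sg, seen as the linear form on cochains it defines. *)
Fixpoint chain k (sg : {set J}) (phi : seq T -> bool) : bool :=
  if k is k'.+1 then
    \big[addb/false]_(j in sg) chain k' (sg :\ j) (cone (H sg) (C sg) phi)
  else phi [::].

Variables (Q : {set J} -> T -> Prop) (D : nat -> T -> T -> Prop).

(** The tuples that make up the chain of [sg]: [Q sg] is the region of the face [sg], and [D k] the
    closeness of vertices in a [k]-tuple, which each coning relaxes from [k] to [k.+1]. *)
Definition small k sg (s : seq T) :=
  [/\ size s = k, forall x, x \in s -> Q sg x &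
      forall x y, x \in s -> y \in s -> D k x y].

Hypothesis H0 : forall sg, H sg 0 =1 id.
Hypothesis QS : forall sg j x, Q (sg :\ j) x -> Q sg x.
Hypothesis QH : forall sg t x, 0 < #|sg| -> t <= N -> Q sg x -> Q sg (H sg t x).
Hypothesis QC : forall sg, 0 < #|sg| -> Q sg (C sg).
Hypothesis DC : forall k sg x, 0 < #|sg| -> Q sg x ->
  D k.+1 (C sg) (H sg N x) /\ D k.+1 (H sg N x) (C sg).
Hypothesis DCC : forall k sg, D k.+1 (C sg) (C sg).
Hypothesis DH : forall k sg t t' x y, 0 < #|sg| -> Q sg x -> Q sg y ->
  t <= N -> t' <= N -> t <= t'.+1 -> t' <= t.+1 ->
  D k x y -> D k.+1 (H sg t x) (H sg t' y).

Lemma cone_local k sg phi psi s : 0 < #|sg| ->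
  small k sg s -> (forall r, small k.+1 sg r -> phi r = psi r) ->
  cone (H sg) (C sg) phi s = cone (H sg) (C sg) psi s.
Proof.
move=> sg0 [ss sQ sD] eqphi; congr addb.
  apply: eq_big_nat => t /andP[_ tN].
  apply: prism_local => r sr rs; apply: eqphi; split; first by rewrite sr ss.
    by move=> y /rs[x /sQ xQ [->|->]]; apply: QH => //; apply: ltnW.
  move=> x y /rs[x' x's ex] /rs[y' y's ey].
  have DD t1 t2 := @DH k sg t1 t2 x' y' sg0 (sQ _ x's) (sQ _ y's).
  by case: ex ey => -> [] ->; apply: DD; rewrite ?(ltnW tN) // 1?leqW //; apply: sD.
apply: eqphi; split; first by rewrite /= size_map ss.
  move=> x; rewrite inE => /orP[/eqP->|/mapP[y ys ->]]; first exact: QC.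
  by apply: QH => //; apply: sQ.
move=> x y; rewrite !inE => /orP[/eqP->|/mapP[x' x's ->]]
  /orP[/eqP->|/mapP[y' y's ->]] //.
- by apply: (DC k sg0 (sQ _ y's)).1.
- by apply: (DC k sg0 (sQ _ x's)).2.
- by apply: DH; rewrite ?leqnSn //; [apply: sQ|apply: sQ|apply: sD].
Qed.

(** Expresses that the chain of [sg] is supported on small tuples. *)
Lemma chain_local k sg phi psi : #|sg| = k ->
  (forall s, small k sg s -> phi s = psi s) -> chain k sg phi = chain k sg psi.
Proof.
elim: k sg phi psi => [|k IHk] sg phi psi sgk eqphi /=.
  by apply: eqphi; split.
have sg0 : 0 < #|sg| by rewrite sgk.
apply: eq_bigr => j jsg; apply: IHk.
  by move: sgk; rewrite (cardsD1 j) jsg => -[].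
move=> s [ss sQ sD]; apply: (@cone_local k) => //.
by split=> // x /sQ /QS.
Qed.

Lemma chainD k sg phi psi :
  chain k sg (fun s => phi s (+) psi s) = chain k sg phi (+) chain k sg psi.
Proof.
elim: k sg phi psi => [|k IHk] sg phi psi //=.
rewrite -big_split /=; apply: eq_bigr => j _; rewrite -IHk.
have chain_ext k' sg' f g : f =1 g -> chain k' sg' f = chain k' sg' g.
  elim: k' sg' f g => [|k' IHk'] sg' f g fg /=; first exact: fg.
  apply: eq_bigr => i _; apply: IHk' => s; rewrite /cone fg; congr addb.
  by apply: eq_bigr => t _; apply: prism_local => r _ _.
apply: chain_ext => s; rewrite /cone.
rewrite (eq_bigr _ (fun t _ => prismD _ _ phi psi s)) big_split /=.
by rewrite addbACA.
Qed.

Lemma chain0 k sg : chain k sg (fun=> false) = false.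
Proof. by have := chainD k sg (fun=> false) (fun=> false); case: chain. Qed.

(** The boundary of the chain of [sg] is the sum of the chains of its facets: [cone_cobd] yields
    these together with cones over the facets of the facets, which cancel in pairs. *)
Lemma chain_cobd k sg phi : #|sg| = k ->
  chain k sg (cobd phi) = \big[addb/false]_(j in sg) chain k.-1 (sg :\ j) phi.
Proof.
elim: k sg phi => [|k IHk] sg phi sgk.
  by rewrite (cards0_eq sgk) big_set0.
rewrite [LHS]/=.
have sgj j : j \in sg -> #|sg :\ j| = k.
  by move: sgk => + jsg; rewrite (cardsD1 j) jsg => -[].
transitivity (\big[addb/false]_(j in sg) (chain k (sg :\ j) phi (+)
   \big[addb/false]_(i in sg :\ j) chain k.-1 (sg :\ j :\ i) (cone (H sg) (C sg) phi))).
  apply: eq_bigr => j jsg; rewrite -IHk ?sgj // -chainD.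
  apply: chain_local; first exact: sgj.
  by move=> s _; apply: cone_cobd.
by rewrite big_split /= (addb_sum_sym sg (fun r => chain k.-1 r _)) addbF.
Qed.

Variable lam : T -> J.
Hypothesis Qlam : forall sg x, Q sg x -> lam x \in sg.

(** Sperner's lemma by induction: the parity count moves the evaluation to the boundary of the
    chain, where only the facet [sg :\ j] can carry all labels except [j]. *)
Lemma chain_rainbow k sg : #|sg| = k -> chain k sg (fun s => rainbow sg (map lam s)).
Proof.
elim: k sg => [|k IHk] sg sgk; first by rewrite /= (cards0_eq sgk) eqxx.
have /card_gt0P[j jsg] : 0 < #|sg| by rewrite sgk.
have sgj i : i \in sg -> #|sg :\ i| = k.
  by move: sgk => + isg; rewrite (cardsD1 i) isg => -[].
rewrite (_ : chain _ _ _ = chain k.+1 sg (cobd (fun s => rainbow (sg :\ j) (map lam s)))).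
  rewrite chain_cobd // (bigD1 j) //= IHk ?sgj //.
  rewrite big1 // => i /andP[isg ij].
  rewrite -[RHS](chain0 k (sg :\ i)); apply: chain_local; first exact: sgj.
  move=> s [_ sQ _]; apply/negP => /rainbowP/(_ i).
  rewrite !inE ij isg => /esym/mapP[x /sQ/Qlam + ei].
  by rewrite -ei !inE eqxx.
apply: chain_local => // s [_ sQ _].
rewrite cobd_map cobd_rainbow //.
by move=> _ /mapP[x /sQ/Qlam xsg ->].
Qed.

Lemma small_rainbow : exists2 s, small #|J| [set: J]%SET s & rainbow [set: J]%SET (map lam s).
Proof.
apply: contrapT => nex.
have := @chain_rainbow #|J| [set: J]%SET (cardsT J).
rewrite (@chain_local _ _ _ (fun=> false)) ?chain0 ?cardsT // => s ss.
by apply/negP => rs; apply: nex; exists s.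
Qed.

End ConeChain.

Local Open Scope classical_set_scope.
Local Open Scope ring_scope.

(** * Inner product, spindles and a theorem of the alternative *)

Section Dot.
Variables (R : realType) (d : nat).
Notation E := 'rV[R]_d.
Implicit Types u v w x y z p q b c e : E.

Definition dot u v : R := \sum_(i < d) u ord0 i * v ord0 i.
Definition nrm2 u : R := dot u u.

Lemma dotC u v : dot u v = dot v u.
Proof. by apply: eq_bigr => i _; rewrite mulrC. Qed.
Lemma dotDl u v w : dot (u + v) w = dot u w + dot v w.
Proof. by rewrite -big_split; apply: eq_bigr => i _; rewrite mxE mulrDl. Qed.
Lemma dotZl a u v : dot (a *: u) v = a * dot u v.
Proof. by rewrite mulr_sumr; apply: eq_bigr => i _; rewrite mxE mulrA. Qed.
Lemma dotNl u v : dot (- u) v = - dot u v.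
Proof. by rewrite -scaleN1r dotZl mulN1r. Qed.
Lemma dotDr u v w : dot u (v + w) = dot u v + dot u w.
Proof. by rewrite dotC dotDl ![dot _ u]dotC. Qed.
Lemma dotZr a u v : dot u (a *: v) = a * dot u v.
Proof. by rewrite dotC dotZl dotC. Qed.
Lemma dotNr u v : dot u (- v) = - dot u v.
Proof. by rewrite dotC dotNl dotC. Qed.
Definition dotE := (dotDl, dotDr, dotNl, dotNr, dotZl, dotZr).

Lemma nrm2_ge0 u : 0 <= nrm2 u.
Proof. by apply: sumr_ge0 => i _; rewrite -expr2 sqr_ge0. Qed.

Lemma nrm2_le0 u : nrm2 u <= 0 -> u = 0.
Proof.
move=> u0; have {u0} : nrm2 u == 0 by rewrite eq_le u0 nrm2_ge0.
rewrite psumr_eq0 => [/allP u0|i _]; last by rewrite -expr2 sqr_ge0.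
apply/rowP => i; rewrite mxE; apply/eqP.
by have := u0 i (mem_index_enum _); rewrite /= mulf_eq0 orbb.
Qed.

Lemma nrm2D u v : nrm2 (u + v) = nrm2 u + 2 * dot u v + nrm2 v.
Proof. by rewrite /nrm2 !dotE (dotC v u); ring. Qed.

Lemma nrm2B u v : nrm2 (u - v) = nrm2 u - 2 * dot u v + nrm2 v.
Proof. by rewrite /nrm2 !dotE (dotC v u); ring. Qed.

Lemma nrm2N u : nrm2 (- u) = nrm2 u.
Proof. by rewrite /nrm2 !dotE opprK. Qed.

Lemma nrm2Z a u : nrm2 (a *: u) = a ^+ 2 * nrm2 u.
Proof. by rewrite /nrm2 !dotE; ring. Qed.

Lemma nrm2_sym u v : nrm2 (u - v) = nrm2 (v - u).
Proof. by rewrite -nrm2N opprB. Qed.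

Lemma nrm2_conv t u v : nrm2 ((1 - t) *: u + t *: v) =
  (1 - t) * nrm2 u + t * nrm2 v - t * (1 - t) * nrm2 (u - v).
Proof. by rewrite nrm2B /nrm2 !dotE (dotC v u); ring. Qed.

Lemma nrm2_conv_le t r u v : 0 <= t <= 1 -> nrm2 u <= r -> nrm2 v <= r ->
  nrm2 ((1 - t) *: u + t *: v) <= r.
Proof.
move=> /andP[t0 t1] ur vr; rewrite nrm2_conv.
have : 0 <= t * (1 - t) * nrm2 (u - v) by rewrite !mulr_ge0 ?nrm2_ge0 ?subr_ge0.
have : 0 <= (1 - t) * (r - nrm2 u) by rewrite mulr_ge0 ?subr_ge0.
have : 0 <= t * (r - nrm2 v) by rewrite mulr_ge0 ?subr_ge0.
lra.
Qed.

Lemma dot_le u v : nrm2 u <= 1 -> nrm2 v <= 1 -> dot u v <= 1.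
Proof. by move=> u1 v1; have := nrm2_ge0 (u - v); rewrite nrm2B; lra. Qed.

Lemma nrm2_comb_le (a b : R) u v : 0 <= a -> 0 <= b -> nrm2 u <= 1 -> nrm2 v <= 1 ->
  nrm2 (a *: u + b *: v) <= (a + b) ^+ 2.
Proof.
move=> a0 b0 u1 v1; rewrite nrm2D !nrm2Z !dotE.
have := dot_le u1 v1; have := nrm2_ge0 u; have := nrm2_ge0 v => v0 u0 uv.
have : a * b * dot u v <= a * b * 1 by rewrite ler_wpM2l ?mulr_ge0.
have : a ^+ 2 * nrm2 u <= a ^+ 2 * 1 by rewrite ler_wpM2l ?sqr_ge0.
have : b ^+ 2 * nrm2 v <= b ^+ 2 * 1 by rewrite ler_wpM2l ?sqr_ge0.
lra.
Qed.

Lemma edistE x y : Defs.edist x y = Num.sqrt (nrm2 (x - y)).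
Proof. by congr Num.sqrt; apply: eq_bigr => i _; rewrite !mxE expr2. Qed.

Lemma edist_le x y r : 0 <= r -> (Defs.edist x y <= r) = (nrm2 (x - y) <= r ^+ 2).
Proof. by move=> r0; rewrite edistE -[r in LHS](ger0_norm r0) -sqrtr_sqr ler_sqrt ?sqr_ge0. Qed.

Lemma spindleP x y z : spindle x y z <->
  (nrm2 (x - y) <= 4 -> forall c, nrm2 (x - c) <= 1 -> nrm2 (y - c) <= 1 ->
   nrm2 (z - c) <= 1).
Proof.
have ball1 (a b : E) : cball1 a b <-> nrm2 (b - a) <= 1.
  by rewrite /cball1 /= edist_le ?ler01 // expr1n.
rewrite /spindle edist_le // (_ : 2 ^+ 2 = 4); last by ring.
case: ifP => xy; last by split.
by split=> [zs _ c /ball1 xc /ball1 yc|zs c /ball1 xc /ball1 yc]; apply/ball1; exact: zs.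
Qed.

Lemma spindle_left x y : spindle x y x.
Proof. by apply/spindleP => _ c. Qed.
Lemma spindle_right x y : spindle x y y.
Proof. by apply/spindleP => _ c. Qed.

Lemma spindle_segment t x y : 0 <= t <= 1 -> spindle x y ((1 - t) *: x + t *: y).
Proof.
move=> t01; apply/spindleP => _ c xc yc.
rewrite (_ : _ - c = (1 - t) *: (x - c) + t *: (y - c)).
  exact: nrm2_conv_le.
by apply/rowP => i; rewrite !mxE; ring.
Qed.

Lemma spindle_diag x z : spindle x x z -> z = x.
Proof.
move=> /spindleP; rewrite subrr {1}/nrm2 /dot big1 => [xz|i _]; last by rewrite mxE mul0r.
have {}xz := xz (ler0n _ 4).
have [/nrm2_le0/eqP|zx] := leP (nrm2 (z - x)) 0; first by rewrite subr_eq0 => /eqP.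
pose r := Num.sqrt (nrm2 (z - x)).
have r2 : r ^+ 2 = nrm2 (z - x) by rewrite sqr_sqrtr // ltW.
have r0 : 0 < r by rewrite sqrtr_gt0.
(* This centre lies at distance 1 from [x], on the side opposite to [z], so its ball excludes
   [z]. *)
have := xz (x - r^-1 *: (z - x)).
rewrite opprD addrA subrr add0r opprK nrm2Z -r2 -exprMn mulVf ?gt_eqF // expr1n lexx.
move=> /(_ isT isT); rewrite addrA -{1}[z - x]scale1r -scalerDl.
rewrite nrm2Z -r2 -exprMn mulrDl mulVf ?gt_eqF // mul1r.
by rewrite expr2 => h; exfalso; nra.
Qed.

(* When p - b and x - b are unit vectors, kap <= be + ga says that w lies beyond
   the chord p x as seen from b. *)
Lemma arc_mem b p x w (be ga kap : R) e : 0 <= be -> 0 <= ga -> 0 <= kap <= be + ga ->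
  0 < be + ga -> be = 0 \/ 1 <= nrm2 (p - b) -> ga = 0 \/ 1 <= nrm2 (x - b) ->
  nrm2 (w - b) <= 1 -> kap *: (w - b) = be *: (p - b) + ga *: (x - b) ->
  nrm2 (p - e) <= 1 -> nrm2 (x - e) <= 1 -> nrm2 (w - e) <= 1.
Proof.
move=> be0 ga0 /andP[kap0 kapl] bg0 pb xb wb wE pe xe.
(* A point at distance at least 1 from [b] lies in the unit ball about [e = b + f] only if its
   offset [v] from [b] satisfies [nrm2 f <= 2 * dot v f]. This linear condition passes to [w], for
   which it is sufficient. *)
pose f := e - b.
have subf y : y - e = (y - b) - f by rewrite /f opprB addrA subrK.
have bf : be * nrm2 f <= 2 * (be * dot (p - b) f).
  case: pb => [->|pb]; first lra.
  by move: pe; rewrite subf nrm2B => pe; rewrite mulrCA ler_wpM2l //; lra.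
have gf : ga * nrm2 f <= 2 * (ga * dot (x - b) f).
  case: xb => [->|xb]; first lra.
  by move: xe; rewrite subf nrm2B => xe; rewrite mulrCA ler_wpM2l //; lra.
have := congr1 (fun v => dot v f) wE; rewrite /= dotDl !dotZl => {}wE.
have f0 := nrm2_ge0 f.
have [k0|k0] := leP kap 0.
  have kE : kap = 0 by lra.
  have : nrm2 f <= 0 by rewrite -(pmulr_rle0 _ bg0); move: wE; rewrite kE mul0r; lra.
  by move=> /nrm2_le0 fE; rewrite subf fE subr0.
rewrite subf nrm2B; suff : nrm2 f <= 2 * dot (w - b) f by lra.
have : 0 <= (be + ga - kap) * nrm2 f by rewrite mulr_ge0 // subr_ge0.
by move=> h; rewrite -(ler_pM2l k0); lra.
Qed.

Lemma small_perturb n (f g : nat -> R) : (forall i, (i < n)%N -> 0 < f i) ->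
  exists2 ep, 0 < ep & forall i, (i < n)%N -> 0 < f i + ep * g i.
Proof.
elim: n => [|n IHn] f0; first by exists 1.
have [i ni|ep ep0 fe] := IHn; first by apply: f0; rewrite ltnS ltnW.
have fn := f0 n (ltnSn n).
pose m := Num.min 1 (f n / (ep * (1 + `|g n|))).
have gn : 0 < ep * (1 + `|g n|) by rewrite mulr_gt0 // ltr_pwDl.
have m0 : 0 < m by rewrite lt_min ltr01 divr_gt0.
have m1 : m <= 1 by rewrite ge_min lexx.
have mf : m * (ep * (1 + `|g n|)) <= f n.
  by rewrite -ler_pdivlMr // ge_min lexx orbT.
exists (m * ep) => [|i]; first by rewrite mulr_gt0.
rewrite ltnS leq_eqVlt => /orP[/eqP->|ni].
  have := ler_norm (- g n); rewrite normrN => ?.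
  have : 0 < m * ep by rewrite mulr_gt0.
  nra.
have := fe i ni; have : 0 < f i by apply: f0; rewrite ltnS ltnW.
nra.
Qed.

(** Gordan's theorem of the alternative, by induction on the number of vectors: when the vector [v]
    found for the first ones fails on the last one [G], then [G] is eliminated. *)
Lemma gordan n (g : nat -> E) :
  (exists v, forall i, (i < n.+1)%N -> 0 < dot v (g i)) \/
  exists a : nat -> R, [/\ forall i, 0 <= a i, 0 < \sum_(i < n.+1) a i &
                           \sum_(i < n.+1) a i *: g i = 0].
Proof.
elim: n g => [|n IHn] g.
  have [/nrm2_le0 g0|g0] := leP (nrm2 (g 0%N)) 0.
    by right; exists (fun=> 1); rewrite !big_ord1 g0 scaler0; split => // i; rewrite ler01.
  by left; exists (g 0%N) => -[].
pose m := n.+1; rewrite -/m in IHn *.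
have [[v vg]|[a [a0 sa ag]]] := IHn g; last first.
  right; exists (fun i => if (i < m)%N then a i else 0); split.
  - by move=> i; case: ifP.
  - rewrite big_ord_recr /= ltnn addr0.
    by under eq_bigr => i _ do rewrite ltn_ord.
  - rewrite big_ord_recr /= ltnn scale0r addr0.
    by under eq_bigr => i _ do rewrite ltn_ord.
pose G := g m; pose mu := dot v G.
have [mu0|mu0] := ltP 0 mu.
  left; exists v => i; rewrite ltnS leq_eqVlt => /orP[/eqP->//|]; exact: vg.
(* These vectors are orthogonal to [v] and are combinations of [G] and [g i] with nonnegative
   coefficients, as [mu <= 0]; a dependence among them is therefore one among the original
   vectors. *)
have [[v' v'g]|[a [a0 sa ag]]] :=
    IHn (fun i => dot v (g i) *: G - mu *: g i); last first.
  right; pose s := \sum_(i < m) a i * dot v (g i).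
  have s0 : 0 < s.
    rewrite /s lt_neqAle sumr_ge0 ?andbT; last first.
      by move=> i _; rewrite mulr_ge0 // ltW // vg.
    apply: contraTneq sa => /esym/eqP; rewrite psumr_eq0; last first.
      by move=> i _; rewrite mulr_ge0 // ltW // vg.
    move=> /allP s0; rewrite big1 ?ltxx // => i _.
    have := s0 i (mem_index_enum _); rewrite /= mulf_eq0 => /orP[/eqP//|].
    by rewrite gt_eqF // vg.
  exists (fun i => if (i < m)%N then - mu * a i else s); split.
  - by move=> i; case: ifP => _; [rewrite mulr_ge0 // oppr_ge0|exact: ltW].
  - rewrite big_ord_recr /= ltnn ltr_wpDl //.
    by apply: sumr_ge0 => i _; rewrite ltn_ord mulr_ge0 // oppr_ge0.
  - rewrite big_ord_recr /= ltnn -[RHS]ag /s scaler_suml -big_split /=.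
    apply: eq_bigr => i _; rewrite ltn_ord -/G scalerBr !scalerA addrC; congr (_ + _).
    by rewrite -scaleNr mulNr mulrC.
have {}v'g i : (i < m)%N -> 0 < dot v (g i) * dot v' G - mu * dot v' (g i).
  by move=> /v'g; rewrite !dotE.
left; have [mu_eq0|mu_lt0] : mu = 0 \/ mu < 0.
  by move: mu0; rewrite le_eqVlt => /orP[/eqP|]; [left|right].
  have [ep ep0 vp] := @small_perturb m (fun i => dot v (g i)) (fun i => dot v' (g i)) vg.
  exists (v + ep *: v') => i; rewrite ltnS leq_eqVlt !dotE => /orP[/eqP->|/vp//].
  rewrite -/G -/mu mu_eq0 add0r mulr_gt0 //.
  by have := v'g 0%N isT; rewrite mu_eq0 mul0r subr0 pmulr_rgt0 // vg.
(* With this [S], the vector [v' + S *: v] is orthogonal to [G] and positive on the other vectors;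
   since [mu < 0], subtracting a little of [v] makes it positive on [G] too. *)
pose S := dot v' G / - mu.
have SE : S * mu = - dot v' G by rewrite /S; field; rewrite lt_eqF.
have [|ep ep0 vp] := @small_perturb m (fun i => dot v' (g i) + S * dot v (g i))
   (fun i => - dot v (g i)).
  move=> i /v'g; rewrite -(pmulr_rgt0 (x := - mu)) ?oppr_gt0 // => h.
  by rewrite -(pmulr_rgt0 _ (_ : 0 < - mu)) ?oppr_gt0 //; nra.
exists (v' + (S - ep) *: v) => i; rewrite ltnS leq_eqVlt !dotE => /orP[/eqP->|/vp].
  by rewrite -/G -/mu; nra.
by rewrite mulrBl mulrN addrA.
Qed.

End Dot.

(** * Compactness of sets of ball centres and first-order optimality *)

Section Optim.
Variables (R : realType) (d : nat).
Notation E := 'rV[R]_d.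
Implicit Types u v w x y z p q b c e : E.

Lemma cvg_dot (T : Type) (F : set_system T) (FF : Filter F) (f g : T -> E) u v :
  f @ F --> u -> g @ F --> v -> (fun t => dot (f t) (g t)) @ F --> dot u v.
Proof.
move=> fu gv; rewrite /dot.
elim: (index_enum _) => [|i s IHs].
  under eq_fun do rewrite big_nil.
  by rewrite big_nil; exact: cvg_cst.
under eq_fun do rewrite big_cons.
rewrite big_cons; apply: cvgD => //.
have coord := @coord_continuous R 1 d ord0 i.
apply: cvgM; first exact: (cvg_comp f (fun M : E => M ord0 i) fu (coord u)).
exact: (cvg_comp g (fun M : E => M ord0 i) gv (coord v)).
Qed.

Lemma cvg_nrm2 (T : Type) (F : set_system T) (FF : Filter F) (f : T -> E) u :
  f @ F --> u -> (fun t => nrm2 (f t)) @ F --> nrm2 u.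
Proof. by move=> fu; exact: cvg_dot. Qed.

Lemma closed_ball2 q r : closed [set b | nrm2 (q - b) <= r].
Proof.
rewrite -/((fun b => nrm2 (q - b)) @^-1` [set t | t <= r]).
apply: (preimage_closed _ (@closed_le _ _)) => b _.
apply: (@cvg_nrm2 _ (nbhs b) _ (fun x => q - x)).
by apply: cvgB; [exact: cvg_cst|exact: cvg_id].
Qed.

Lemma coord_nrm2 u i : (u ord0 i) ^+ 2 <= nrm2 u.
Proof.
rewrite /nrm2 /dot (bigD1 i) //= expr2 lerDl.
by apply: sumr_ge0 => j _; rewrite -expr2 sqr_ge0.
Qed.

Lemma norm_coord (u : E) i : `|u ord0 i| <= `|u|.
Proof.
rewrite [leRHS]/Num.norm /= mx_normrE.
by apply/bigmax_geP; right; exists (ord0, i).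
Qed.

Lemma norm_le_coord (u : E) M : 0 <= M -> (forall i, `|u ord0 i| <= M) -> `|u| <= M.
Proof.
move=> M0 uM; rewrite [leLHS]/Num.norm /= mx_normrE.
by apply/bigmax_leP; split=> // -[i j] _; rewrite ord1; exact: uM.
Qed.

Lemma compact_ball2 q : compact [set b | nrm2 (q - b) <= 1].
Proof.
apply: bounded_closed_compact; last exact: closed_ball2.
exists (`|q| + 1); split; first exact: num_real.
move=> M /ltW qM b /= qb; apply: le_trans qM.
rewrite -[b](subKr q) (le_trans (ler_normB _ _)) // lerD2l.
apply: norm_le_coord => // i.
rewrite -(ler_pXn2r (_ : 0 < 2)%N) ?nnegrE // expr1n real_normK ?num_real //.
exact: le_trans (coord_nrm2 _ _) qb.
Qed.

Lemma compact_balls (ps : seq E) : (0 < size ps)%N ->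
  compact [set b | forall q, q \in ps -> nrm2 (q - b) <= 1].
Proof.
case: ps => // p ps _; apply: (@subclosed_compact _ _ [set b | nrm2 (p - b) <= 1]).
- rewrite (_ : [set b | _] = \bigcap_(q in [set` p :: ps]) [set b | nrm2 (q - b) <= 1]) //.
  by apply: closed_bigI => q _; exact: closed_ball2.
- exact: compact_ball2.
- by move=> b; apply; rewrite inE eqxx.
Qed.

Lemma near_inward p v : nrm2 p <= 1 -> (nrm2 p = 1 -> 0 < dot v p) ->
  \forall s \near 0^'+, nrm2 (p - s *: v) <= 1.
Proof.
rewrite le_eqVlt => /orP[/eqP p1 /(_ p1) vp|p1 _].
  have [v0|v0] := leP (nrm2 v) 0.
    by apply: nearW => s; rewrite (nrm2_le0 v0) scaler0 subr0 p1.
  near=> s.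
  have s0 : 0 < s by near: s; exact: nbhs_right_gt.
  have : s < dot v p / nrm2 v.
    by near: s; apply: nbhs_right_lt; exact: divr_gt0.
  rewrite ltr_pdivlMr // nrm2B nrm2Z p1 dotZr (dotC p) => sv.
  have : s * (s * nrm2 v) <= s * dot v p by rewrite ler_wpM2l ?ltW.
  have : 0 < s * dot v p by rewrite mulr_gt0.
  rewrite expr2; lra.
have : (fun s : R => nrm2 (p - s *: v)) @ 0^'+ --> nrm2 p.
  rewrite -[X in _ --> nrm2 X](subr0 p) -(scale0r v).
  apply: cvg_nrm2; apply: cvgB; first exact: cvg_cst.
  apply: cvgZr_tmp; exact: cvg_at_right_filter.
by move=> /cvgr_le; apply.
Unshelve. all: by end_near. Qed.

(** Multipliers of Fritz John type for a centre [b] of a unit ball containing [ps]: Gordan's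
    alternative is applied to [u] and the active constraints, and [near_inward] turns its first case
    into a feasible motion. *)
Lemma kkt (ps : seq E) b u : (forall q, q \in ps -> nrm2 (q - b) <= 1) ->
  (forall v, 0 < dot v u -> (\forall s \near 0^'+,
     forall q, q \in ps -> nrm2 (q - (b + s *: v)) <= 1) -> False) ->
  exists lam (a : nat -> R), [/\ 0 <= lam,
    forall i, 0 <= a i,
    forall i, (i < size ps)%N -> a i = 0 \/ nrm2 (nth 0 ps i - b) = 1,
    0 < lam + \sum_(i < size ps) a i &
    lam *: u + \sum_(i < size ps) a i *: (nth 0 ps i - b) = 0].
Proof.
move=> feas noimp; pose n := size ps.
pose act i := nrm2 (nth 0 ps i - b) == 1.
(* Inactive indices and the extra index [n] all carry [u], so their multipliers add up to [lam]. *)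
pose g i := if (i < n)%N && act i then nth 0 ps i - b else u.
have [[v vg]|[a [a0 sa ag]]] := gordan n g.
  exfalso; apply: (noimp v).
    by have := vg n (ltnSn n); rewrite /g ltnn.
  have near1 i : (i < n)%N ->
      \forall s \near 0^'+, nrm2 (nth 0 ps i - (b + s *: v)) <= 1.
    move=> ni; have : \forall s \near 0^'+, nrm2 (nth 0 ps i - b - s *: v) <= 1.
      apply: near_inward; first by apply: feas; rewrite mem_nth.
      by move=> /eqP acti; have := vg i (ltnW ni); rewrite /g ni /act acti.
    by apply: filterS => s; rewrite opprD addrA.
  have : \forall s \near 0^'+, forall i : 'I_n, nrm2 (nth 0 ps i - (b + s *: v)) <= 1.
    by apply: filter_forall => i; exact: near1.
  apply: filterS => s h q qps.
  have qn : (index q ps < n)%N by rewrite index_mem.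
  by have := h (Ordinal qn); rewrite /= nth_index.
exists (a n + \sum_(i < n | ~~ act i) a i), (fun i => if act i then a i else 0).
split.
- by rewrite addr_ge0 ?sumr_ge0.
- by move=> i; case: ifP.
- by move=> i _; rewrite /act; case: eqP; [right|left].
- move: sa; rewrite big_ord_recr /= (bigID (fun i : 'I_n => act i)) /=.
  by rewrite [X in 0 < X + _ + _ -> _]big_mkcond /=; lra.
- rewrite -[RHS]ag big_ord_recr /= {2}/g ltnn /= scalerDl -addrA [RHS]addrC; congr (_ + _).
  rewrite scaler_suml [RHS](bigID (fun i : 'I_n => act i)) /= addrC; congr (_ + _).
    rewrite [RHS]big_mkcond /=; apply: eq_bigr => i _; rewrite /g ltn_ord /=.
    by case: ifP => //; rewrite scale0r.
  by apply: eq_bigr => i /negPf acti; rewrite /g acti andbF.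
Qed.

End Optim.

(** * Spindle convex joins *)

Section Join.
Variables (R : realType) (d : nat).
Notation E := 'rV[R]_d.
Implicit Types u v w x y z p q b c e : E.

Lemma le_of_sqr (a b : R) : 0 <= b -> a ^+ 2 <= b ^+ 2 -> a <= b.
Proof.
by move=> b0 ab; rewrite (le_trans (ler_norm a)) // -(ler_pXn2r (_ : 0 < 2)%N) ?nnegrE
  // real_normK ?num_real.
Qed.

(* If no unit ball contains c, p and x, some w of [p, x]_s has [c, w]_s equal to
   the whole space: b is the point nearest to c among the centres of the unit balls
   containing p and x, and w is opposite to c at distance 1 from b. *)
Lemma join_far c p x : nrm2 (p - x) <= 4 ->
  ~ (exists b, [/\ nrm2 (c - b) <= 1, nrm2 (p - b) <= 1 & nrm2 (x - b) <= 1]) ->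
  exists2 w, spindle p x w & 4 < nrm2 (c - w).
Proof.
move=> px noball; pose ps := [:: p; x].
pose L := [set b | forall q, q \in ps -> nrm2 (q - b) <= 1].
have L0 : L !=set0.
  have half q r : nrm2 (q - r) <= 4 -> nrm2 (q - 2^-1 *: (q + r)) <= 1.
    move=> qr; rewrite (_ : q - _ = 2^-1 *: (q - r)); last by apply/rowP => i; rewrite !mxE; lra.
    by rewrite nrm2Z; lra.
  exists (2^-1 *: (p + x)) => q; rewrite !inE => /orP[]/eqP->; first exact: half.
  by rewrite (addrC p) half // nrm2_sym.
have [|b bL bmin] := EVT_min_rV (f := fun b => nrm2 (b - c)) L0 (@compact_balls R d ps isT).
  apply: continuous_subspaceT => y; apply: (@cvg_nrm2 _ _ _ (nbhs y) _ (fun b => b - c)).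
  by apply: cvgB; [exact: cvg_id|exact: cvg_cst].
move: bL; rewrite inE => bL.
have pb : nrm2 (p - b) <= 1 by apply: bL; rewrite inE eqxx.
have xb : nrm2 (x - b) <= 1 by apply: bL; rewrite !inE eqxx orbT.
pose D := nrm2 (c - b).
have D1 : 1 < D by rewrite ltNge; apply/negP => cb; apply: noball; exists b.
(* A feasible motion of [b] with positive component towards [c] would contradict that [b] is nearest
   to [c]. *)
have [v vu vs|lam [a [lam0 a0 acta suma suma0]]] := kkt bL (u := c - b).
  have v0 : 0 < nrm2 v.
    rewrite lt_neqAle nrm2_ge0 andbT; apply: contraTneq vu => /esym/eqP v0.
    by rewrite (@nrm2_le0 _ _ v) ?(eqP v0) // /dot big1 ?ltxx // => i _; rewrite mxE mul0r.
  have /filter_ex[s [s0 sv feas]] : \forall s \near 0^'+,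
      [/\ 0 < s, s < dot v (c - b) / nrm2 v & L (b + s *: v)].
    near=> s; split; last by near: s.
      by near: s; exact: nbhs_right_gt.
    by near: s; apply: nbhs_right_lt; exact: divr_gt0.
  move: sv; rewrite ltr_pdivlMr // => sv.
  have := bmin _ (mem_set feas).
  rewrite -!(nrm2_sym c) opprD addrA (nrm2B (c - b)) nrm2Z dotZr (dotC (c - b)) => h.
  have : s * (s * nrm2 v) < s * dot v (c - b) by rewrite ltr_pM2l.
  have : 0 < s * dot v (c - b) by rewrite mulr_gt0.
  move: h; rewrite expr2; lra.
move: suma suma0; rewrite !big_ord_recl !big_ord0 /= !addr0 => suma suma0.
set a1 := a 0%N in suma suma0; set a2 := a (bump 0 0) in suma suma0.
pose r := Num.sqrt D.
have r2 : r ^+ 2 = D by rewrite sqr_sqrtr // /D nrm2_ge0.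
have r1 : 1 < r by rewrite -sqrtr1 ltr_sqrt // (lt_trans ltr01).
have rn0 : r != 0 by rewrite gt_eqF // (lt_trans ltr01).
have eqw : lam *: (b - c) = a1 *: (p - b) + a2 *: (x - b).
  by apply/eqP; rewrite -(opprB c b) scalerN eq_sym -subr_eq0 opprK addrC suma0.
(* Comparing lengths in [eqw] bounds [lam * r] by the sum of the weights, as [arc_mem] requires. *)
have lamle : (lam * r) ^+ 2 <= (a1 + a2) ^+ 2.
  rewrite exprMn r2 /D nrm2_sym -nrm2Z eqw.
  by apply: nrm2_comb_le => //; apply: a0.
have a12 : 0 <= a1 + a2 by rewrite addr_ge0 //; apply: a0.
have {}lamle : lam * r <= a1 + a2 by apply: le_of_sqr.
exists (b + r^-1 *: (b - c)).
  apply/spindleP => _ e; apply: (@arc_mem _ _ b _ _ _ a1 a2 (lam * r)) => //.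
  - exact: a0.
  - exact: a0.
  - by rewrite lamle mulr_ge0 // ltW // (lt_trans ltr01).
  - rewrite lt_neqAle a12 andbT; apply: contraTneq suma => /esym a0'; rewrite a0' addr0.
    rewrite a0' in lamle; rewrite -leNgt; nra.
  - by case: (acta 0%N isT) => /= h; [left|right; rewrite h].
  - by case: (acta 1%N isT) => /= h; [left|right; rewrite h].
  - by rewrite addrAC subrr add0r nrm2Z -(opprB c b) nrm2N -/D exprVn -r2 mulVf ?expf_neq0.
  - by rewrite addrAC subrr add0r scalerA mulfK.
rewrite opprD addrA -[c - b]scale1r -(opprB c b) scalerN opprK -scalerDl nrm2Z -/D.
rewrite -r2.
rewrite -exprMn mulrDl mulVf // mul1r expr2; nra.
Unshelve. all: by end_near. Qed.

(** No unit ball containing [c], [p] and [x] can be moved off [z], so optimality at [b] makes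
    [z - b] a nonnegative combination of the offsets of these points. The part from [p] and [x],
    scaled to length 1, gives [w]. *)
Lemma join_tight c p x z b :
  [/\ nrm2 (c - b) <= 1, nrm2 (p - b) <= 1 & nrm2 (x - b) <= 1] ->
  nrm2 (z - b) = 1 ->
  (forall b', nrm2 (c - b') <= 1 -> nrm2 (p - b') <= 1 -> nrm2 (x - b') <= 1 ->
     nrm2 (z - b') <= 1) ->
  exists2 w, spindle p x w & spindle c w z.
Proof.
move=> [cb pb xb] zb zmax; pose ps := [:: c; p; x].
have [|v vu vs|lam [a [lam0 a0 acta]]] := @kkt _ _ ps b (b - z).
- by move=> q; rewrite !inE => /or3P[]/eqP->.
- have /filter_ex[s [s0 feas]] : \forall s \near 0^'+,
      0 < s /\ forall q, q \in ps -> nrm2 (q - (b + s *: v)) <= 1.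
    by near=> s; split; near: s => //; exact: nbhs_right_gt.
  have : nrm2 (z - (b + s *: v)) <= 1.
    by apply: zmax; apply: feas; rewrite !inE eqxx ?orbT.
  rewrite opprD addrA nrm2B zb nrm2Z dotZr -(opprB b z) dotNl dotC.
  have : 0 < s * dot v (b - z) by rewrite mulr_gt0.
  have : 0 <= s ^+ 2 * nrm2 v by rewrite mulr_ge0 ?sqr_ge0 ?nrm2_ge0.
  lra.
rewrite !big_ord_recl !big_ord0 /= !addr0 => suma suma0.
have [A0 [A1 A2]] := (a0 0%N, (a0 1%N, a0 2%N)).
have [C0 [C1 C2]] := (acta 0%N isT, (acta 1%N isT, acta 2%N isT)).
rewrite /= in C0 C1 C2.
have : exists al be ga : R, [/\ 0 <= al, 0 <= be & 0 <= ga] /\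
    [/\ al = 0 \/ 1 <= nrm2 (c - b), be = 0 \/ 1 <= nrm2 (p - b),
       ga = 0 \/ 1 <= nrm2 (x - b), 0 < lam + (al + (be + ga)) &
       lam *: (z - b) = al *: (c - b) + (be *: (p - b) + ga *: (x - b))].
  exists (a 0%N), (a 1%N), (a 2%N); split=> //; split.
  - by case: C0 => ->; [left|right].
  - by case: C1 => ->; [left|right].
  - by case: C2 => ->; [left|right].
  - exact: suma.
  - by apply/eqP; rewrite -(opprB b z) scalerN eq_sym -subr_eq0 opprK addrC; apply/eqP.
move=> [al [be [ga [[al0 be0 ga0] [alc bep gax sum0 zE]]]]].
clear suma suma0 A0 A1 A2 C0 C1 C2.
(* Without weight on [p] and [x], the point [z] coincides with [c], and [w = p] will do. *)
have [s0|s0] := leP (be + ga) 0.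
  have [beE gaE] : be = 0 /\ ga = 0 by split; lra.
  rewrite beE gaE !scale0r !addr0 in zE; rewrite beE gaE !addr0 in sum0.
  have lamal : lam <= al + 0.
    rewrite addr0; apply: le_of_sqr => //.
    rewrite -[lam ^+ 2]mulr1 -zb -nrm2Z zE nrm2Z -[leRHS]mulr1.
    by rewrite ler_wpM2l ?sqr_ge0.
  exists p; first exact: spindle_left.
  apply/spindleP => _ e; apply: (@arc_mem _ _ b _ _ _ al 0 lam) => //.
  - by rewrite lam0.
  - lra.
  - by left.
  - by rewrite zb.
  - by rewrite scale0r addr0.
pose W := be *: (p - b) + ga *: (x - b).
pose k := Num.sqrt (nrm2 W).
have k2 : k ^+ 2 = nrm2 W by rewrite sqr_sqrtr // nrm2_ge0.
have ks : k <= be + ga.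
  by apply: le_of_sqr; rewrite ?k2 ?(ltW s0) //; apply: nrm2_comb_le.
have k0 : 0 <= k by exact: sqrtr_ge0.
(* If [W] vanishes, [p] and [x] are antipodal on the sphere about [b], so their spindle is the whole
   ball and contains [z]. *)
have [kz|kn0] := eqVneq k 0.
  exists z; last exact: spindle_right.
  apply/spindleP => _ e; apply: (@arc_mem _ _ b _ _ _ be ga 0) => //.
  - by rewrite lexx ltW.
  - by rewrite zb.
  - rewrite scale0r -/W; apply/esym/nrm2_le0.
    by rewrite -k2 kz expr0n.
have kp : 0 < k by rewrite lt_neqAle eq_sym kn0.
pose w := b + k^-1 *: W.
have wb : nrm2 (w - b) = 1.
  by rewrite /w addrAC subrr add0r nrm2Z exprVn -k2 mulVf // expf_neq0.
have kw : k *: (w - b) = W by rewrite /w addrAC subrr add0r scalerA mulfV // scale1r.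
exists w.
  apply/spindleP => _ e; apply: (@arc_mem _ _ b _ _ _ be ga k) => //.
  - by rewrite k0.
  - by rewrite wb.
apply/spindleP => _ e; apply: (@arc_mem _ _ b _ _ _ al k lam) => //.
- rewrite lam0 /=; apply: le_of_sqr; first exact: addr_ge0.
  rewrite -[lam ^+ 2]mulr1 -zb -nrm2Z zE -/W -kw.
  by apply: nrm2_comb_le; rewrite ?wb.
- by rewrite ltr_wpDl.
- by right; rewrite wb.
- by rewrite zb.
- by rewrite kw.
Unshelve. all: by end_near. Qed.

End Join.

(** * Spindle joins, kernels and closedness *)

Section Kernel.
Variables (R : realType) (d : nat).
Notation E := 'rV[R]_d.
Implicit Types u v w x y z p q b c e : E.
Implicit Types (A S : set E).

Lemma spindle_conv t x y z z' : 0 <= t <= 1 -> spindle x y z -> spindle x y z' ->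
  spindle x y ((1 - t) *: z + t *: z').
Proof.
move=> t01 /spindleP zs /spindleP z's; apply/spindleP => xy c xc yc.
rewrite (_ : _ - c = (1 - t) *: (z - c) + t *: (z' - c)).
  by apply: nrm2_conv_le => //; [exact: zs|exact: z's].
by apply/rowP => i; rewrite !mxE; ring.
Qed.

(** If no unit ball contains the three points, [join_far] applies. Otherwise [z] is pushed along the
    ray from [c] until [join_tight] applies, and convexity of [c, w]_s brings it back. *)
Lemma spindle_join c p x z : nrm2 (p - x) <= 4 ->
  (forall b, nrm2 (c - b) <= 1 -> nrm2 (p - b) <= 1 -> nrm2 (x - b) <= 1 ->
     nrm2 (z - b) <= 1) ->
  exists2 w, spindle p x w & spindle c w z.
Proof.
move=> px zb.
have [[b0 [cb0 pb0 xb0]]|noball] :=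
    pselect (exists b, [/\ nrm2 (c - b) <= 1, nrm2 (p - b) <= 1 & nrm2 (x - b) <= 1]);
  last first.
  have [w pxw cw] := join_far px noball.
  by exists w => //; apply/spindleP; rewrite leNgt cw.
have [/nrm2_le0/eqP|D0] := leP (nrm2 (z - c)) 0.
  rewrite subr_eq0 => /eqP ->.
  by exists p; [exact: spindle_left|exact: spindle_left].
pose D := nrm2 (z - c); rewrite -/D in D0.
pose zt t := c + t *: (z - c).
pose f (bt : E * R) := nrm2 (zt bt.2 - bt.1).
pose M := [set b | forall q, q \in [:: c; p; x] -> nrm2 (q - b) <= 1].
have MP b : M b <-> [/\ nrm2 (c - b) <= 1, nrm2 (p - b) <= 1 & nrm2 (x - b) <= 1].
  split=> [Mb|[cb pb xb] q]; first by split; apply: Mb; rewrite !inE eqxx ?orbT.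
  by rewrite !inE => /or3P[]/eqP->.
(* Push z away from c until it reaches the boundary of the spindle hull. *)
pose t1 := 1 + 4 / D.
have t11 : 1 <= t1 by rewrite lerDl divr_ge0 // ltW.
pose P := (M `*` `[1, t1]%classic) `&` [set bt | 1 <= f bt].
have fcont : continuous f.
  move=> bt; apply: (@cvg_nrm2 _ _ _ (nbhs bt) _ (fun bt => zt bt.2 - bt.1)).
  apply: cvgB; last exact: cvg_fst.
  by apply: cvgD; [exact: cvg_cst|apply: cvgZr_tmp; exact: cvg_snd].
have cP : compact P.
  apply: compact_closedI.
    by apply: compact_setX; [exact: compact_balls|exact: segment_compact].
  rewrite -/(f @^-1` [set t | 1 <= t]).
  by apply: (preimage_closed _ (@closed_ge _ _)) => bt _; exact: fcont.
(* At [t1] the point of the ray is at distance at least 2 from [c], so it is not interior to any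
   unit ball containing [c]. *)
have P0 : P !=set0.
  exists (b0, t1); split; first by split; [apply/MP|rewrite /= in_itv /= t11 lexx].
  rewrite /= /f /zt /= addrAC nrm2D nrm2Z dotZr -/D.
  have : 0 <= nrm2 (t1 *: (z - c) + 2 *: (c - b0)) by exact: nrm2_ge0.
  rewrite nrm2D !nrm2Z dotZl dotZr (dotC (z - c)) -/D => h.
  have : 4 <= t1 ^+ 2 * D.
    have : t1 * D = D + 4 by rewrite /t1 mulrDl mul1r divfK // gt_eqF.
    have := nrm2_ge0 (c - b0); rewrite expr2; nra.
  by move: h; lra.
have [|[b t0] + tmin] := compact_EVT_min (f := snd : E * R -> R) P0 cP.
  by apply: continuous_subspaceT => y; exact: cvg_snd.
rewrite inE => -[[/= /MP Mb t0b] fb]; move: t0b; rewrite /= in_itv /= => /andP[t01 t0t1].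
have tmin' b' t : M b' -> 1 <= t <= t1 -> 1 <= f (b', t) -> t0 <= t.
  move=> Mb' tb fbt; apply: (tmin (b', t)); apply/mem_set; split; last exact: fbt.
  by split; [exact: Mb'|rewrite /= in_itv].
(* A ball leaving out [zt t0] would also leave out slightly earlier points of the ray, against the
   minimality of [t0]; for [t0 = 1] this is the hypothesis on [z]. *)
have zmax b' : nrm2 (c - b') <= 1 -> nrm2 (p - b') <= 1 -> nrm2 (x - b') <= 1 ->
     nrm2 (zt t0 - b') <= 1.
  move=> cb' pb' xb'; rewrite leNgt; apply/negP => fb'.
  have Mb' : M b' by apply/MP.
  have [t0E|t0n1] := eqVneq t0 1.
    move: fb'; rewrite /zt t0E scale1r (addrC c) subrK ltNge => /negP; apply.
    exact: zb.
  have {t0n1} t0gt : 1 < t0 by rewrite lt_neqAle eq_sym t0n1.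
  have leftP : \forall t \near t0^'-,
      [/\ 1 < f (b', t), t < t0 & 1 < t].
    near=> t; split; near: t.
    - have : (fun t => f (b', t)) @ t0^'- --> f (b', t0).
        apply: cvg_at_left_filter.
        apply: (@cvg_nrm2 _ _ _ (nbhs t0) _ (fun t => zt t - b')).
        apply: cvgB; last exact: cvg_cst.
        by apply: cvgD; [exact: cvg_cst|apply: cvgZr_tmp; exact: cvg_id].
      by move=> /cvgr_gt; apply.
    - exact: nbhs_left_lt.
    - exact: nbhs_left_gt.
  have [t lt] := @filter_ex _ (t0^'-) _ _ leftP.
  case: lt => ft tt0 t1t.
  have := tmin' b' t Mb'; rewrite (ltW t1t) (ltW ft) (ltW (lt_le_trans tt0 t0t1)).
  by rewrite leNgt tt0 => /(_ isT isT).
have [cb pb xb] := Mb.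
have zb1 : nrm2 (zt t0 - b) = 1 by apply/eqP; rewrite eq_le zmax.
have [w pxw cwz] := join_tight Mb zb1 zmax.
exists w => //.
have t0p : 0 < t0 by rewrite (lt_le_trans ltr01).
have -> : z = (1 - t0^-1) *: c + t0^-1 *: zt t0.
  rewrite /zt scalerDr scalerA mulVf ?gt_eqF // scale1r addrA -scalerDl subrK scale1r.
  by rewrite (addrC c) subrK.
apply: spindle_conv => //; last exact: spindle_left.
by rewrite invr_ge0 (ltW t0p) /= invf_le1.
Unshelve. all: by end_near. Qed.

Lemma ker_sP A p : ker_s A p <-> A p /\ forall q, A q -> spindle p q `<=` A.
Proof.
split=> [[Ap stA]|[Ap pA]]; split=> //.
  by move=> q Aq; move: Aq; rewrite -[in X in X -> _]stA => -[].
by apply/seteqP; split=> q; [case|move=> Aq; split=> //; exact: pA].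
Qed.

(** Every unit ball containing [c], [p] and [x] contains the left-hand spindle, so [spindle_join]
    places its points on spindles from [c] to points of [p, x]_s, which lie in [A]. *)
Lemma spindle_cone A c p x t : ker_s A c -> A p -> A x -> spindle p x `<=` A ->
  0 <= t <= 1 -> spindle ((1 - t) *: c + t *: p) x `<=` A.
Proof.
move=> /ker_sP[_ cA] Ap Ax pxA t01 z /spindleP zs.
have [px|px] := leP (nrm2 (p - x)) 4; last first.
  by apply: pxA; apply/spindleP; rewrite leNgt px.
have [cx|cx] := leP (nrm2 (c - x)) 4; last first.
  by apply: (cA x Ax); apply/spindleP; rewrite leNgt cx.
have conv q : (1 - t) *: c + t *: p - q = (1 - t) *: (c - q) + t *: (p - q).
  by apply/rowP => i; rewrite !mxE; ring.
have [b cb pb xb|w pxw cwz] := @spindle_join c p x z px.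
  by apply: zs => //; rewrite conv; apply: nrm2_conv_le.
exact: (cA w (pxA w pxw) z cwz).
Qed.

(** The spindle depends lower semicontinuously on [p]: every point of [p, x]_s is a limit of points
    that remain in [p', x]_s for all [p'] near [p]. *)
Lemma closed_spindle_sub S x : closed S -> S x -> closed [set p | spindle p x `<=` S].
Proof.
move=> clS Sx p clp z pxz.
have [px|px] := leP (nrm2 (p - x)) 4; last first.
  have : \forall p' \near p, 4 < nrm2 (p' - x).
    have : (fun p' => nrm2 (p' - x)) @ p --> nrm2 (p - x).
      by apply: (@cvg_nrm2 _ _ _ (nbhs p) _ (fun p' => p' - x)); apply: cvgB; [exact: cvg_id|exact: cvg_cst].
    by move=> /cvgr_gt; apply.
  move=> /clp[p' [/= p'S p'x]]; apply: p'S.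
  by apply/spindleP; rewrite leNgt p'x.
have [/nrm2_le0/eqP|px0] := leP (nrm2 (p - x)) 0.
  by rewrite subr_eq0 => /eqP pE; move: pxz; rewrite pE => /spindle_diag ->.
pose m := 2^-1 *: (p + x).
pose zs s := (1 - s) *: z + s *: m.
(* zs s is interior to every unit ball containing p and x, which survives a small
   perturbation of p. *)
suff zsS s : 0 < s <= 1 -> S (zs s).
  apply: (@closed_cvg _ _ (0 : R)^'+ _ zs S clS).
    near=> s; apply: zsS; apply/andP; split; near: s; first exact: nbhs_right_gt.
    exact: nbhs_right_le.
  have -> : z = zs 0 by rewrite /zs subr0 scale1r scale0r addr0.
  apply: cvg_at_right_filter; apply: cvgD; apply: cvgZr_tmp; last exact: cvg_id.
  by apply: cvgB; [exact: cvg_cst|exact: cvg_id].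
move=> /andP[s0 s1].
suff : \forall p' \near p, spindle p' x (zs s).
  by move=> /clp[p' [/= p'S]]; exact: p'S.
have strict c : nrm2 (x - c) <= 1 -> nrm2 (p - c) <= 1 -> nrm2 (zs s - c) < 1.
  move=> xc pc; have /spindleP/(_ px c pc xc) zc := pxz.
  have mc : nrm2 (m - c) < 1.
    rewrite (_ : m - c = (1 - 2^-1) *: (p - c) + 2^-1 *: (x - c)); last first.
      by apply/rowP => i; rewrite !mxE; lra.
    rewrite nrm2_conv (_ : p - c - (x - c) = p - x); last first.
      by rewrite opprB addrA subrK.
    lra.
  rewrite (_ : zs s - c = (1 - s) *: (z - c) + s *: (m - c)); last first.
    by apply/rowP => i; rewrite !mxE; ring.
  rewrite nrm2_conv.
  have : 0 <= s * (1 - s) * nrm2 (z - c - (m - c)).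
    by rewrite !mulr_ge0 ?nrm2_ge0 ?subr_ge0 // ltW.
  have : 0 <= (1 - s) * (1 - nrm2 (z - c)) by rewrite mulr_ge0 ?subr_ge0.
  have : 0 < s * (1 - nrm2 (m - c)) by rewrite mulr_gt0 ?subr_gt0.
  lra.
(* Compactness of the set of centres of unit balls containing [x] gives one neighbourhood of [p]
   that serves all of them. *)
have /compact_near_coveringP/(_ E (nbhs p)
  (fun p' c => nrm2 (p' - c) <= 1 -> nrm2 (zs s - c) <= 1) _) := @compact_ball2 R d x.
have cball : forall c, nrm2 (x - c) <= 1 -> \forall x' \near c & i \near p,
    nrm2 (i - x') <= 1 -> nrm2 (zs s - x') <= 1.
  move=> c xc; have [pc|pc] := leP (nrm2 (p - c)) 1.
    have : (fun ci : E * E => nrm2 (zs s - ci.1)) @ (c, p) --> nrm2 (zs s - c).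
      by apply: cvg_nrm2; apply: cvgB; [exact: cvg_cst|exact: cvg_fst].
    move=> /cvgr_lt/(_ _ (strict c xc pc)); apply: filterS => -[c' p'] /= h _.
    exact: ltW.
  have : (fun ci : E * E => nrm2 (ci.2 - ci.1)) @ (c, p) --> nrm2 (p - c).
    by apply: cvg_nrm2; apply: cvgB; [exact: cvg_snd|exact: cvg_fst].
  move=> /cvgr_gt/(_ _ pc); apply: filterS => -[c' p'] /= h.
  by rewrite leNgt h.
move=> /(_ cball); apply: filterS => p' h.
by apply/spindleP => _ c p'c xc; exact: h.
Unshelve. all: by end_near. Qed.

End Kernel.

(** * A Helly theorem for starshaped intersections *)

Section Label.
Variables (R : realType) (d : nat).
Notation E := 'rV[R]_d.

Variables (h : R) (h0 : 0 < h).

Definition grid_round (t : R) (x : E) : E :=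
  \row_i (h * (Num.floor (x ord0 i / h + t))%:~R).

Lemma grid_round_dist t x : 0 <= t <= 1 -> `|x - grid_round t x| <= h.
Proof.
move=> /andP[t0 t1]; apply: norm_le_coord; first exact: ltW.
move=> i; rewrite !mxE -[X in X - _](divfK (lt0r_neq0 h0)) mulrC -mulrBr.
rewrite normrM gtr0_norm // ger_pMr //.
have := floor_le (x ord0 i / h + t); have := floorD1_gt (x ord0 i / h + t).
by rewrite intrD ler_norml; lra.
Qed.

Let D : R := d.+1%:R.
Let D0 : 0 < D. Proof. by rewrite ltr0n. Qed.
Let mu : R := (4 * D)^-1.
Let mu0 : 0 < mu. Proof. by rewrite invr_gt0 mulr_gt0. Qed.

Definition shift (k : 'I_d.+1) : R := k%:R / D.

Lemma shift01 k : 0 <= shift k <= 1.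
Proof.
by rewrite /shift divr_ge0 ?(ltW D0) //= ler_pdivrMr // mul1r ler_nat ltnW.
Qed.

Definition good_shift (k : 'I_d.+1) (x : E) := forall i,
  let y := x ord0 i / h + shift k in
  (Num.floor y)%:~R + mu <= y < (Num.floor y)%:~R + 1 - mu.

(** Pigeonhole: two of the d + 1 shifts differ modulo 1 by at least 1 / (d + 1), more than twice the
    margin [mu], so each of the d coordinates spoils at most one shift. *)
Lemma good_shift_exists x : exists k, good_shift k x.
Proof.
apply: contrapT => nogood.
have bad k : exists i, exists m : int, `|x ord0 i / h + shift k - m%:~R| <= mu.
  apply: contrapT => nobad; apply: nogood; exists k => i /=.
  set y := _ + shift k; have := floor_le y; have := floorD1_gt y.
  rewrite intrD => yl yg.
  apply/andP; split; [rewrite leNgt|rewrite ltNge]; apply/negP => yb; apply: nobad; exists i.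
    by exists (Num.floor y); rewrite -/y ler_norml; lra.
  by exists (Num.floor y + 1); rewrite -/y intrD ler_norml; lra.
have [f fP] := choice bad.
have : injective f.
  move=> k k' fk; apply: contrapT => /eqP kk'.
  wlog lt_kk' : k k' fk kk' / (k < k')%N.
    move=> wl; case: (ltngtP k k') => [|lt|/val_inj e].
    - exact: wl.
    - by apply: (wl k' k) => //; rewrite eq_sym.
    - by rewrite e eqxx in kk'.
  have [m hm] := fP k; have [m' hm'] := fP k'; rewrite -fk in hm'.
  have sh : shift k' - shift k = (k' - k)%:R / D.
    by rewrite natrB ?(ltnW lt_kk') // mulrBl.
  have lo : D^-1 <= (k' - k)%:R / D.
    by rewrite ler_peMl ?invr_ge0 ?(ltW D0) // ler1n subn_gt0.
  have hi : (k' - k)%:R / D <= 1 - D^-1.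
    rewrite ler_pdivrMr // mulrBl mulVf ?gt_eqF // mul1r.
    have : (k' - k).+1%:R <= D.
      by rewrite ler_nat ltnS (leq_trans (leq_subr _ _)) // -ltnS.
    by rewrite -natr1; lra.
  have muE : 4 * mu = D^-1 by rewrite /mu invfM mulrA divff ?mul1r.
  have Di : 0 < D^-1 by rewrite invr_gt0.
  move: hm hm'; rewrite !ler_norml => /andP[h1 h2] /andP[h3 h4].
  have [lo' hi'] : (0 : R) < (m' - m)%:~R /\ (m' - m)%:~R < (1 : R).
    rewrite intrB; move: sh lo hi muE Di h1 h2 h3 h4.
    move: ((k' - k)%:R / D) D^-1 (x ord0 (f k) / h) (shift k) (shift k').
    by move: m%:~R m'%:~R mu => M M' u q g y s s' ; split; lra.
  by move: lo' hi'; rewrite ltr0z gtz0_ge1 ltrz1 ltNge => ->.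
by move=> /leq_card; rewrite !card_ord ltnn.
Qed.

Lemma grid_round_good k x x0 : good_shift k x -> `|x - x0| <= h * mu ->
  grid_round (shift k) x = grid_round (shift k) x0.
Proof.
move=> gk xx0; apply/rowP => i; rewrite !mxE; congr (_ * _%:~R).
apply/esym/floor_def; rewrite intrD.
have /andP[yl yg] := gk i.
have : `|x ord0 i / h - x0 ord0 i / h| <= mu.
  rewrite -mulrBl normrM [X in _ * X]gtr0_norm ?invr_gt0 // ler_pdivrMr // mulrC.
  apply: le_trans xx0; have := norm_coord (x - x0) i; by rewrite !mxE.
rewrite ler_norml => /andP[]; lra.
Qed.

(* Round x to a grid after a diagonal shift by k / (d + 1), with k chosen so
   that no coordinate is close to a jump: k takes d + 1 values, and each
   coordinate excludes at most one. Locally only k matters for the result. *)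
Lemma few_labels (L : finType) (l : E -> L) : exists lam : E -> L,
  (forall x, exists2 t, 0 <= t <= 1 & lam x = l (grid_round t x)) /\
  exists2 del, 0 < del & forall x0, exists f : 'I_d.+1 -> L,
     forall x, `|x - x0| <= del -> lam x \in codom f.
Proof.
have [s sP] := choice good_shift_exists.
exists (fun x => l (grid_round (shift (s x)) x)); split.
  by move=> x; exists (shift (s x)) => //; exact: shift01.
exists (h * mu); first exact: mulr_gt0.
move=> x0; exists (fun k => l (grid_round (shift k) x0)) => x xx0.
by rewrite (grid_round_good (sP x) xx0) codom_f.
Qed.

End Label.

(** * From few local labels to a common point *)

Section Helly.
Variables (R : realType) (d : nat).
Notation E := 'rV[R]_d.

(** A Lebesgue number for the cover of the compact set [T ord0] by the complements of the [T j];
    points far from [T ord0] take [j = ord0]. *)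
Lemma uniform_avoidance n (T : 'I_n.+1 -> set E) : (forall i, compact (T i)) ->
  ~ (exists u, forall j, T j u) ->
  exists2 ep : R, 0 < ep & forall p, exists j, forall x, T j x -> ep <= `|p - x|.
Proof.
move=> cT noT.
have near0 : \forall ep \near (0 : R)^'+, T ord0 `<=`
    (fun q => exists j, forall x, T j x -> ep <= `|q - x|).
  apply: (proj1 (compact_near_coveringP _) (cT ord0)) => q Tq.
  have [j Tjq] : exists j, ~ T j q.
    by apply: contrapT => nex; apply: noT; exists q => j; apply: contrapT => nT; apply: nex; exists j.
  have opT : open (~` T j) by rewrite openC; apply: compact_closed => //; exact: norm_hausdorff.
  have /nbhs_ballP[r /= r0 rT] : nbhs q (~` T j) by exact: open_nbhs_nbhs.
  exists (ball q (r / 2), [set ep | ep < r / 2]).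
    split; first by apply: nbhsx_ballx; rewrite divr_gt0.
    by apply: nbhs_right_lt; rewrite divr_gt0.
  move=> [q' ep] [/= qq' epr]; exists j => x Tx; rewrite leNgt; apply/negP => q'x.
  apply: (rT x) => //; rewrite -ball_normE /= in qq' *.
  by rewrite -(subrKA q') (le_lt_trans (ler_normD _ _)) //; lra.
have near1 : \forall ep \near (0 : R)^'+, 0 < ep /\ T ord0 `<=`
    (fun q => exists j, forall x, T j x -> ep <= `|q - x|).
  by near=> ep; split; near: ep => //; exact: nbhs_right_gt.
have [ep [ep0 epT]] := @filter_ex _ (0 : R)^'+ _ _ near1.
exists (ep / 2); first by rewrite divr_gt0.
move=> p; have [[q Tq pq]|noq] := pselect (exists2 q, T ord0 q & `|p - q| < ep / 2).
  have [j jT] := epT q Tq; exists j => x /jT qx; rewrite leNgt; apply/negP => px.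
  have := ler_distD p q x; rewrite (distrC q p); lra.
exists ord0 => x Tx; rewrite leNgt; apply/negP => px.
by apply: noq; exists x.
Unshelve. all: by end_near. Qed.

(** The face [sg] gets as region the intersection of the [T j] with [j] outside [sg], which [H sg]
    contracts to its centre [C sg] in [N] steps. Labels on this region lie in [sg], so
    [small_rainbow] applies. *)
Lemma starshaped_helly n (T : 'I_n -> set E) : (d.+1 < n)%N ->
  (forall i, compact (T i)) ->
  (forall J : {set 'I_n}, (0 < #|J| < n)%N ->
    exists c, (forall j, j \in J -> T j c) /\
      forall u t, (forall j, j \in J -> T j u) -> 0 <= t <= 1 ->
        forall j, j \in J -> T j ((1 - t) *: c + t *: u)) ->
  exists u, forall j, T j u.
Proof.
case: n T => // n T dn cT starT; apply: contrapT => noT.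
have [ep ep0 avoid] := uniform_avoidance cT noT.
have [l lP] := choice avoid.
pose h := ep / 2; have h0 : 0 < h by rewrite divr_gt0.
have [lam [lamE [del del0 few]]] := few_labels h0 l.
(* Rounding moves [x] by at most [ep / 2], whereas the grid point keeps distance [ep] from the set
   named by its label. *)
have lamT j x : T j x -> lam x != j.
  move=> Tx; apply/eqP => lx; have [t t01 lt] := lamE x.
  have := lP (grid_round h t x) x; rewrite -lt lx => /(_ Tx).
  by have := grid_round_dist h0 x t01; rewrite distrC /h; lra.
have [B0 [B0r TB0]] : \forall B \near +oo, forall i x, T i x -> `|x| <= B.
  have : \forall B \near +oo, forall i, forall x, T i x -> `|x| <= B.
    by apply: filter_forall => i; exact: compact_bounded (cT i).
  by [].
pose B := Num.max 1 (B0 + 1).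
have TB i x : T i x -> `|x| <= B.
  by apply: TB0; rewrite lt_max ltrDl ltr01 orbT.
have B1 : 1 <= B by rewrite le_max lexx.
have B00 : 0 <= B by rewrite (le_trans ler01).
(* The value for empty [sg] is a dummy; for the full [sg] the conditions on the sets are void and 0
   serves. *)
have centers : forall sg : {set 'I_n.+1}, exists c, (0 < #|sg|)%N ->
    [/\ `|c| <= B, forall j, j \notin sg -> T j c &
      forall u t, (forall j, j \notin sg -> T j u) -> 0 <= t <= 1 ->
        forall j, j \notin sg -> T j ((1 - t) *: c + t *: u)].
  move=> sg; have [sg0|sgn0] := posnP #|sg|; first by exists 0.
  have [sgT|[j jsg]] : (forall j, j \in sg) \/ exists j, j \notin sg.
    have [/forallP|/forallPn] := boolP [forall j, j \in sg]; first by left.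
    by move=> [j jsg]; right; exists j.
    exists 0 => _; split; first by rewrite normr0.
      by move=> j; rewrite sgT.
    by move=> u t _ _ j; rewrite sgT.
  have [|c [cT' cstar]] := starT (~: sg)%SET.
    rewrite cardsCs finset.setCK card_ord subn_gt0 ltn_subrL sgn0 andbT.
    rewrite -[n.+1 in X in (_ < X)%N](card_ord n.+1) -cardsT; apply: proper_card.
    by rewrite properT; apply: contraNneq jsg => ->; rewrite inE.
  exists c => _; split.
  - by apply: (TB j); apply: cT'; rewrite inE.
  - by move=> i isg; apply: cT'; rewrite inE.
  - move=> u t Tu t01 i isg; apply: cstar; rewrite ?inE // => k.
    by rewrite inE; exact: Tu.
have [C CP] := choice centers.
(* One step of a contraction moves a point by at most [2 * B / N], and each coning adds one such
   error, so the final tuples have diameter at most [del]. *)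
have [N N0 Ndel] : exists2 N, (0 < N)%N & n.+1%:R * (2 * B / N%:R) <= del.
  pose M := n.+1%:R * (2 * B) / del.
  have M0 : 0 <= M by rewrite divr_ge0 ?mulr_ge0 // ltW.
  have : M < (Num.bound M).+1%:R.
    by rewrite (lt_le_trans (archi_boundP M0)) // ler_nat leqnSn.
  rewrite ltr_pdivrMr // => /ltW MN.
  by exists (Num.bound M).+1 => //; rewrite mulrA ler_pdivrMr ?ltr0n // (mulrC del).
pose eta := 2 * B / N%:R.
have eta0 : 0 <= eta by rewrite divr_ge0 ?mulr_ge0.
have Nr0 : (0 : R) < N%:R by rewrite ltr0n.
pose H (sg : {set 'I_n.+1}) (t : nat) (u : E) := (1 - (1 - t%:R / N%:R)) *: C sg + (1 - t%:R / N%:R) *: u.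
have t01 t : (t <= N)%N -> 0 <= 1 - t%:R / N%:R :> R /\ 1 - t%:R / N%:R <= 1 :> R.
  move=> tN; have : 0 <= t%:R / N%:R :> R by rewrite divr_ge0.
  have : t%:R / N%:R <= 1 :> R by rewrite ler_pdivrMr // mul1r ler_nat.
  by split; lra.
pose Q (sg : {set 'I_n.+1}) x := (forall j, j \notin sg -> T j x) /\ `|x| <= B.
pose near k (x y : E) := `|x - y| <= k%:R * eta.
have QH (sg : {set 'I_n.+1}) t x : (0 < #|sg|)%N -> (t <= N)%N -> Q sg x -> Q sg (H sg t x).
  move=> sg0 tN [Tx xB]; have [cB Tc cstar] := CP sg sg0; have [t0 t1] := t01 t tN.
  split; first by apply: cstar => //; rewrite t0.
  rewrite (le_trans (ler_normD _ _)) // !normrZ (ger0_norm t0) ger0_norm ?subr_ge0 //.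
  move: t0 t1; move: (1 - t%:R / N%:R) => a a0 a1.
  have : a * `|x| <= a * B by rewrite ler_wpM2l.
  have : (1 - a) * `|C sg| <= (1 - a) * B by rewrite ler_wpM2l // subr_ge0.
  by lra.
have nearH k (sg : {set 'I_n.+1}) t t' x y : (0 < #|sg|)%N -> Q sg x -> Q sg y -> (t <= N)%N -> (t' <= N)%N ->
    (t <= t'.+1)%N -> (t' <= t.+1)%N -> near k x y -> near k.+1 (H sg t x) (H sg t' y).
  move=> sg0 [_ xB] [_ yB] tN t'N tt' t't xy; have [cB _ _] := CP sg sg0.
  have [t0 t1] := t01 t tN.
  rewrite /near (_ : H sg t x - H sg t' y =
    (1 - t%:R / N%:R) *: (x - y) + ((t'%:R - t%:R) / N%:R) *: (y - C sg)); last first.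
    by apply/rowP => i; rewrite !mxE; field; rewrite gt_eqF.
  rewrite (le_trans (ler_normD _ _)) // !normrZ (ger0_norm t0).
  have -> : k.+1%:R * eta = k%:R * eta + eta by rewrite -natr1 mulrDl mul1r.
  apply: lerD.
    by apply: le_trans xy; rewrite ler_piMl.
  rewrite [`|_^-1|]gtr0_norm ?invr_gt0 // /eta mulrAC.
  apply: ler_wpM2r; first by rewrite invr_ge0 ltW.
  have tt1 : `|t'%:R - t%:R| <= 1 :> R.
    have : t%:R <= t'.+1%:R :> R by rewrite ler_nat.
    have : t'%:R <= t.+1%:R :> R by rewrite ler_nat.
    by rewrite -!natr1 ler_norml; lra.
  have yC : `|y - C sg| <= 2 * B by rewrite (le_trans (ler_normB _ _)) //; lra.
  by rewrite -[2 * B]mul1r; apply: ler_pM.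
have QC (sg : {set 'I_n.+1}) : (0 < #|sg|)%N -> Q sg (C sg).
  by move=> /CP[].
have H0 (sg : {set 'I_n.+1}) : H sg 0%N =1 id.
  by move=> x; rewrite /H mul0r subr0 subrr scale0r add0r scale1r.
have HN (sg : {set 'I_n.+1}) x : H sg N x = C sg.
  by rewrite /H divff ?gt_eqF // subrr subr0 scale1r scale0r addr0.
have nearCC k (sg : {set 'I_n.+1}) : near k.+1 (C sg) (C sg).
  by rewrite /near subrr normr0 mulr_ge0.
have QS (sg : {set 'I_n.+1}) j x : Q (sg :\ j)%SET x -> Q sg x.
  move=> [Tx xB]; split=> // i isg; apply: Tx.
  by rewrite !inE negb_and isg orbT.
have Qlam (sg : {set 'I_n.+1}) x : Q sg x -> lam x \in sg.
  move=> [Tx _]; apply/negPn/negP => /Tx /lamT; by rewrite eqxx.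
have [|s [ss _ snear] srain] := @small_rainbow _ _ N H C Q near H0 QS QH QC _ nearCC nearH lam Qlam.
  by move=> k sg x _ _; rewrite HN.
have lab j : exists2 x, x \in s & j = lam x.
  by have /rainbowP/(_ j) := srain; rewrite inE => /esym/mapP.
case: s => [|x0 s] in ss snear lab {srain} *; first by have [] := lab ord0.
have [f fP] := few x0.
(* All [n.+1] labels occur within [del] of [x0], where only [d.+1] are available. *)
have : (#|'I_n.+1| <= #|'I_d.+1|)%N.
  rewrite -(size_image f 'I_d.+1) cardE; apply: uniq_leq_size; first exact: enum_uniq.
  move=> j _; have [x xs ->] := lab j; apply: fP.
  have : near #|'I_n.+1| x x0 by apply: snear; rewrite // inE eqxx.
  by rewrite /near card_ord => /le_trans; apply.
by rewrite !card_ord leqNgt dn.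
Qed.

End Helly.

(** * Kernels of intersections *)

Section Main.
Variables (R : realType) (d : nat).
Notation E := 'rV[R]_d.
Implicit Types (A X K : set E) (u v c : E).

(* The sets T_i of the header. *)
Definition sees A X K : set E :=
  [set u | forall k, K k -> A (u + k) /\ forall x, X x -> spindle (u + k) x `<=` A].

Lemma sees_bigcap (I : Type) (D : set I) (S : I -> set E) X K u :
  sees (\bigcap_(i in D) S i) X K u <-> forall i, D i -> sees (S i) X K u.
Proof.
split=> [su i Di k /su[Sk xS]|su k Kk].
  by split=> [|x Xx y /(xS x Xx) yS]; [exact: Sk|exact: yS].
split=> [i Di|x Xx y uy i Di]; first by have [] := su i Di k Kk.
by have [_ xS] := su i Di k Kk; exact: xS uy.
Qed.

Lemma sees_self X K u : sees X X K u <-> (fun k => u + k) @` K `<=` ker_s X.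
Proof.
split=> [su _ [k /su kX <-]|uK k Kk]; first exact/ker_sP.
by apply/ker_sP; apply: uK; exists k.
Qed.

Lemma ker_sees A X K c : X `<=` A -> (fun k => c + k) @` K `<=` ker_s A -> sees A X K c.
Proof.
move=> XA /sees_self cA k /cA[Ak cAk]; split=> // x /XA; exact: cAk.
Qed.

Lemma sees_cone A X K c u t : X `<=` A -> (fun k => c + k) @` K `<=` ker_s A ->
  sees A X K u -> 0 <= t <= 1 -> sees A X K ((1 - t) *: c + t *: u).
Proof.
move=> XA cA su t01 k Kk; have [Auk uS] := su k Kk.
have ck : ker_s A (c + k) by apply: cA; exists k.
have -> : (1 - t) *: c + t *: u + k = (1 - t) *: (c + k) + t *: (u + k).
  by rewrite !scalerDr addrACA -scalerDl subrK scale1r.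
split; last by move=> x Xx; apply: spindle_cone => //; [exact: XA|exact: uS].
have [_ ckA] := (ker_sP A (c + k)).1 ck.
exact: (ckA _ Auk _ (spindle_segment _ _ t01)).
Qed.

Lemma compact_sees A X K : compact A -> X `<=` A -> K !=set0 -> compact (sees A X K).
Proof.
move=> cA XA [k0 Kk0].
have clA : closed A by apply: compact_closed => //; exact: norm_hausdorff.
have shift k : continuous (fun u : E => u + k).
  by move=> u; apply: (@cvgD R E _ (nbhs u) _ (fun v => v)); [exact: cvg_id|exact: cvg_cst].
have cl_shift (k : E) (B : set E) : closed B -> closed [set u | B (u + k)].
  move=> clB; rewrite -/((fun u : E => u + k) @^-1` B).
  by apply: preimage_closed => // u _; exact: shift.
apply: (@subclosed_compact _ _ ((fun u => u - k0) @` A)).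
- rewrite (_ : sees A X K = \bigcap_(k in K) ([set u | A (u + k)] `&`
     \bigcap_(x in X) [set u | spindle (u + k) x `<=` A])) //.
  apply: closed_bigI => k _; apply: closedI; first exact: cl_shift.
  apply: closed_bigI => x Xx.
  by apply: (cl_shift k [set p | spindle p x `<=` A]); apply: closed_spindle_sub => //; exact: XA.
- apply: continuous_compact => //; apply: continuous_subspaceT; exact: shift.
- by move=> u /(_ k0 Kk0)[Au _]; exists (u + k0); rewrite // addrK.
Qed.

(** The Helly theorem applied to the m + 1 sets [sees (S j) X K]; [ker_sees] and [sees_cone] show
    that proper subfamilies have starshaped intersections. *)
Lemma kernel_step m (S : 'I_m.+1 -> set E) K : (d < m)%N -> K !=set0 ->
  (forall i, compact (S i)) ->
  (forall g : 'I_m -> 'I_m.+1, exists u,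
     (fun k => u + k) @` K `<=` ker_s (\bigcap_(j in [set: 'I_m]) S (g j))) ->
  exists u, (fun k => u + k) @` K `<=` ker_s (\bigcap_(j in [set: 'I_m.+1]) S j).
Proof.
move=> dm K0 cS sub; pose X := \bigcap_(j in [set: 'I_m.+1]) S j.
have XS j : X `<=` S j by move=> x; exact.
have [|||u uT] := @starshaped_helly R d m.+1 (fun j => sees (S j) X K).
- by rewrite ltnS.
- by move=> j; apply: compact_sees.
- move=> J /andP[/card_gt0P[j0 j0J] Jm].
  (* The hypothesis speaks of exactly [m] indices, so the list of [J] is padded with its element
     [j0]. *)
  have [c cA] := sub (fun i => nth j0 (enum J) i).
  set A := \bigcap_(j in _) _ in cA.
  have JA u : sees A X K u <-> forall j, j \in J -> sees (S j) X K u.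
    split=> [/sees_bigcap su j jJ|su].
      have jm : (index j (enum J) < m)%N.
        by rewrite (leq_trans _ (_ : #|J| <= m)%N) // cardE index_mem mem_enum.
      by have := su (Ordinal jm) I; rewrite /= nth_index ?mem_enum.
    apply/sees_bigcap => i _; apply: su.
    have [iJ|Ji] := ltnP i (size (enum J)); last by rewrite nth_default.
    by rewrite -mem_enum mem_nth.
  have XA : X `<=` A by move=> x Xx i _; exact: XS.
  exists c; split; first by apply/JA; exact: ker_sees.
  by move=> u t /JA su t01; apply/JA; exact: sees_cone.
by exists u; apply/sees_self/sees_bigcap => j _.
Qed.

Lemma kernel_finite (I : Type) (S : I -> set E) K m : (d < m)%N -> K !=set0 ->
  (forall i, compact (S i)) ->
  (forall g : 'I_d.+1 -> I, exists u,
     (fun k => u + k) @` K `<=` ker_s (\bigcap_(j in [set: 'I_d.+1]) S (g j))) ->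
  forall g : 'I_m -> I, exists u,
     (fun k => u + k) @` K `<=` ker_s (\bigcap_(j in [set: 'I_m]) S (g j)).
Proof.
move=> dm K0 cS base; elim: m dm => // m IHm.
rewrite ltnS leq_eqVlt => /orP[/eqP<- //|dm] g.
by apply: (@kernel_step m (S \o g)) => // [i|f]; [exact: cS|exact: (IHm dm (g \o f))].
Qed.

End Main.

(** * Arbitrary families by compactness *)

Unset Implicit Arguments. Set Strict Implicit.

Theorem theorem5 (R : realType) (d : nat) (I : Type) (S : I -> set 'rV[R]_d)
  (K : set 'rV[R]_d) :
  (forall i, compact (S i)) ->
  (forall i, spindle_starshaped (S i)) ->
  (exists f : 'I_d.+1 -> I, injective f) ->
  compact K ->
  (forall g : 'I_d.+1 -> I, exists u : 'rV[R]_d,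
      (fun k => u + k) @` K `<=` ker_s (\bigcap_(j in [set: 'I_d.+1]) S (g j))) ->
  exists v : 'rV[R]_d,
    (fun k => v + k) @` K `<=` ker_s (\bigcap_(i in [set: I]) S i).
Proof.
move=> cS _ [f _] _ base; pose i0 := f ord0.
have [->|/set0P K0] := eqVneq K set0; first by exists 0; rewrite image_set0.
pose X := \bigcap_(i in [set: I]) S i.
pose T (i : {classic I}) := sees (S i) X K.
have XS i : X `<=` S i by move=> x; exact.
have cT i : compact (T i) by apply: compact_sees.
(* The finite intersection property is used inside the compact set [T i0]. *)
have : \bigcap_(i in [set: {classic I}]) (T i0 `&` T i) !=set0.
  have := cT i0; rewrite compact_In0; apply.
    exists T => // i _; apply: compact_closed => //; exact: norm_hausdorff.
  move=> D' _; pose s := finmap.enum_fset D'.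
  (* The length is at least d + 1 and exceeds the size of [s], so the default [i0] is itself among
     the indices. *)
  pose g (j : 'I_(maxn d (size s)).+1) := nth (i0 : {classic I}) s j.
  have [|u uA] := kernel_finite _ K0 cS base g; first by rewrite ltnS leq_maxl.
  have gT j : T (g j) u.
    have XA : X `<=` \bigcap_(j in [set: 'I_(maxn d (size s)).+1]) S (g j).
      by move=> x Xx k _; exact: XS.
    by have /sees_bigcap/(_ j Logic.I) := ker_sees XA uA.
  have idx i : (i <= size s)%N -> T (nth (i0 : {classic I}) s i) u.
    move=> si; have im : (i < (maxn d (size s)).+1)%N.
      by rewrite ltnS (leq_trans si) // leq_maxr.
    exact: (gT (Ordinal im)).
  exists u => i /= iD; split; first by have := idx _ (leqnn _); rewrite nth_default.
  by have := idx _ (index_size i s); rewrite nth_index.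
case=> v vT; exists v; apply/sees_self/sees_bigcap => i _.
by have [] := vT i Logic.I.
Qed.
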